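(* Let $\mathbb{K}$ be a countably infinite field, and let $E\subset\mathbb{K}^2$ be a set with positive upper Banach density. Then $\operatorname{Prod}(E-E)=\mathbb{K}$. Moreover, for every finite set $Q\subset\mathbb{K}$, there exists an element $u_Q\in E$ such that $Q\subset\operatorname{Prod}(E-u_Q)$.
   Context: For $E\subset\mathbb{K}^2$, $\operatorname{Prod}(E)=\{xy : (x,y)\in E\}\subset\mathbb{K}$; $E-E=\{e-e':e,e'\in E\}$ and $E-u=\{e-u:e\in E\}$. For a countable abelian group $A$ (here $(\mathbb{K}^2,+)$), a Følner sequence is a sequence $(F_n)$ of non-empty finite subsets with $|F_n\cap(F_n+b)|/|F_n|\to1$ for every $b\in A$, and the upper Banach density of $E\subset A$ is $d^*(E)=\sup_{(F_n)}\limsup_{n\to\infty}|E\cap F_n|/|F_n|$, the supremum being over all Følner sequences in $A$. *)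

(* Defs.v *)
From mathcomp Require Import all_boot all_order all_algebra finmap.
From mathcomp Require Import all_classical all_reals all_analysis.

Set Implicit Arguments.
Unset Strict Implicit.
Unset Printing Implicit Defensive.

Import Order.TTheory GRing.Theory Num.Theory.
Import numFieldNormedType.Exports.

Local Open Scope classical_set_scope.
Local Open Scope ring_scope.

Section UpperBanachDensity.
Variables (R : realType) (A : zmodType).

Definition fshift (F : {fset A}) (b : A) : {fset A} :=
  [fset (x + b)%R | x in F]%fset.

Definition folner (F : nat -> {fset A}) : Prop :=
  (forall n, F n != fset0) /\
  forall b : A,
    (#|` (F n `&` fshift (F n) b)%fset|%:R / #|` F n|%:R : R)
      @[n --> \oo] --> (1 : R).

Definition rel_density (E : set A) (F : {fset A}) : R :=
  #|` [fset x in F | x \in E]%fset|%:R / #|` F|%:R.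

(* Valued in the extended reals, so that the supremum and the limsup need no
   boundedness side conditions. *)
Definition upper_banach_density (E : set A) : \bar R :=
  ereal_sup [set limn_esup (fun n => (rel_density E (F n))%:E)
            | F in [set F | folner F]].

Definition diffset (E : set A) : set A := [set x - y | x in E & y in E].

Definition translate_sub (E : set A) (u : A) : set A := [set x - u | x in E].

End UpperBanachDensity.

Definition Prod (K : fieldType) (E : set (K * K)) : set K :=
  [set p.1 * p.2 | p in E].

(* Main.v *)
Require Import Defs.
From mathcomp Require Import all_boot all_order all_algebra finmap.
From mathcomp Require Import all_classical all_reals all_analysis.
From mathcomp Require Import ring lra.

Set Implicit Arguments.
Unset Strict Implicit.
Unset Printing Implicit Defensive.

Import Order.TTheory GRing.Theory Num.Theory.
Import numFieldNormedType.Exports.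

Local Open Scope classical_set_scope.
Local Open Scope ring_scope.

(** Positive upper Banach density yields a finitely additive, translation
    invariant mean m on bounded functions on the plane with m(1_E) > 0.  If no
    point of E saw all of the finite set Q, then E would be the union, over q in
    Q, of the sets of points of E that miss q, and one of these sets would have
    positive m-measure.  So it suffices to show that a set S with m(1_S) > 0
    contains two points u, v with (v.1 - u.1)(v.2 - u.2) = q
    ([exists_difference_on_hyperbola]); for q = 0 one takes u = v.

    Assume that q <> 0 and that there are no such points.  The function
    psi p = m(1_S 1_(S - p)) - m(1_S)^2 is positive semidefinite (it is the
    autocorrelation of 1_S - m(1_S)) and equals - m(1_S)^2 < 0 on the whole
    hyperbola xy = q.  The torus K^*, acting by t.(x, y) = (tx, y/t), preserves
    the hyperbola.  It is countable and abelian, so averaging psi successively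
    along the powers of each of its elements with a Banach limit produces a
    torus-invariant positive semidefinite phi that is still negative on the
    hyperbola ([exists_torus_invariant]).

    Such a phi cannot exist ([torus_invariant_hyperbola_ge0]).  Invariance makes
    phi constant on each axis (origin excluded) and makes it a function of the
    product, phi (x, y) = g (xy), off the axes.  The main tool is
    [psd_concentration]: think of phi (p - o) as the scalar product of vectors
    e_p and e_o of norm at most 1; if all scalar products within a family of 2N
    vectors are nearly equal, then the averages of two halves of the family are
    close to each other, so they have nearly the same scalar product with any
    e_o.
    - For points on an axis, the scalar products are exactly equal; testing
      against a point off that axis shows that g is nearly a constant d outside
      a finite set Z.
    - On the hyperbola, for fixed s, (t - s)(q/t - q/s) takes each value for
      only finitely many t, so one can choose N points of the hyperbola whose pairwise
      differences have products outside Z, and N further points in general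
      position with respect to them and to the origin.  All scalar products are
      then close to d; testing against the origin shows that g q is close to d.
    - Finally d is almost nonnegative, being close to the squared norm of the
      average of many e_p.
    Hence g q >= 0. *)

(** * Means on bounded functions *)

Section Means.
Variable R : realType.

Definition bdd (T : Type) (f : T -> R) := exists B : R, forall x, `|f x| <= B.

Lemma bddD T (f g : T -> R) : bdd f -> bdd g -> bdd (fun x => f x + g x).
Proof.
move=> [B fB] [C gC]; exists (B + C) => x.
by apply: (le_trans (ler_normD _ _)); apply: lerD.
Qed.

Lemma bddM T (f g : T -> R) : bdd f -> bdd g -> bdd (fun x => f x * g x).
Proof.
by move=> [B fB] [C gC]; exists (B * C) => x; rewrite normrM ler_pM.
Qed.

Lemma bdd_cst T (c : R) : bdd (fun _ : T => c).
Proof. by exists `|c|. Qed.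

Lemma bddZ T c (f : T -> R) : bdd f -> bdd (fun x => c * f x).
Proof. by apply: bddM; apply: bdd_cst. Qed.

Lemma bddB T (f g : T -> R) : bdd f -> bdd g -> bdd (fun x => f x - g x).
Proof.
move=> [B fB] [C gC]; exists (B + C) => x.
by apply: (le_trans (ler_normB _ _)); apply: lerD.
Qed.

Lemma bdd_comp T U (f : T -> R) (h : U -> T) : bdd f -> bdd (fun x => f (h x)).
Proof. by move=> [B fB]; exists B. Qed.

Lemma bdd_sum T I (s : seq I) (f : I -> T -> R) :
  (forall i, bdd (f i)) -> bdd (fun x => \sum_(i <- s) f i x).
Proof.
move=> fb; elim: s => [|i s IHs].
  by exists 0 => x; rewrite big_nil normr0.
by under [X in bdd X]eq_fun do rewrite big_cons; apply: bddD.
Qed.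

Lemma bdd_indic T (E : set T) : bdd (\1_E : T -> R).
Proof.
by exists 1 => x; rewrite indicE; case: (x \in E); rewrite ?normr1 ?normr0 ?ler01.
Qed.

Record is_mean T (m : (T -> R) -> R) : Prop := IsMean {
  mean_ge0 : forall f, bdd f -> (forall x, 0 <= f x) -> 0 <= m f;
  meanD : forall f g, bdd f -> bdd g -> m (fun x => f x + g x) = m f + m g;
  meanZ : forall c f, bdd f -> m (fun x => c * f x) = c * m f;
  mean1 : m (fun _ => 1) = 1 }.

Section MeanTheory.
Variables (T : Type) (m : (T -> R) -> R).
Hypothesis mm : is_mean m.

Lemma mean_cst c : m (fun _ => c) = c.
Proof.
have := meanZ mm c (bdd_cst T 1); rewrite (mean1 mm) mulr1 => {2}<-.
by congr m; apply/funext => x; rewrite mulr1.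
Qed.

Lemma meanB f g : bdd f -> bdd g -> m (fun x => f x - g x) = m f - m g.
Proof.
move=> fb gb; rewrite -mulN1r -meanZ// -meanD//; last exact: bddZ.
by congr m; apply/funext => x; rewrite mulN1r.
Qed.

Lemma mean_le f g : bdd f -> bdd g -> (forall x, f x <= g x) -> m f <= m g.
Proof.
move=> fb gb fg; rewrite -subr_ge0 -meanB//; apply: mean_ge0 => // [|x].
  exact: bddB.
by rewrite subr_ge0.
Qed.

Lemma mean_norm_le f B : (forall x, `|f x| <= B) -> `|m f| <= B.
Proof.
move=> fB; have fb : bdd f by exists B.
rewrite ler_norml -[X in X <= _ <= _]mean_cst -[X in _ <= _ <= X]mean_cst.
by apply/andP; split; apply: mean_le => // [|x]; try exact: bdd_cst;
  have := fB x; rewrite ler_norml => /andP[].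
Qed.

Lemma mean_sum I (s : seq I) (f : I -> T -> R) : (forall i, bdd (f i)) ->
  m (fun x => \sum_(i <- s) f i x) = \sum_(i <- s) m (f i).
Proof.
move=> fb; elim: s => [|i s IHs].
  by rewrite big_nil -[RHS]mean_cst; congr m; apply/funext => x; rewrite big_nil.
rewrite big_cons -IHs -meanD//; last exact: bdd_sum.
by congr m; apply/funext => x; rewrite big_cons.
Qed.

End MeanTheory.

Definition avg T (s : seq T) (f : T -> R) := (\sum_(x <- s) f x) / (size s)%:R.

Lemma avg_cst T (s : seq T) c : (0 < size s)%N -> avg s (fun _ => c) = c.
Proof.
move=> s0; rewrite /avg big_const_seq count_predT iter_addr_0.
by rewrite -[c *+ _]mulr_natr mulfK// pnatr_eq0 -lt0n.
Qed.

Lemma avg_le T (s : seq T) f g : (forall x, f x <= g x) -> avg s f <= avg s g.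
Proof. by move=> fg; rewrite ler_wpM2r ?invr_ge0// ler_sum. Qed.

Lemma avgD T (s : seq T) f g : avg s (fun x => f x + g x) = avg s f + avg s g.
Proof. by rewrite /avg big_split mulrDl. Qed.

Lemma avgZ T (s : seq T) c f : avg s (fun x => c * f x) = c * avg s f.
Proof. by rewrite /avg -mulr_sumr mulrA. Qed.

Lemma avgB T (s : seq T) f g : avg s (fun x => f x - g x) = avg s f - avg s g.
Proof.
by rewrite -mulN1r -avgZ -avgD; congr avg; apply/funext => x; rewrite mulN1r.
Qed.

Lemma avg_norm_le T (s : seq T) f B : (0 < size s)%N ->
  (forall x, `|f x| <= B) -> `|avg s f| <= B.
Proof.
move=> s0 fB; rewrite ler_norml -{1}(avg_cst (- B) s0) -[X in _ <= _ <= X](avg_cst B s0).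
by apply/andP; split; apply: avg_le => x; have := fB x; rewrite ler_norml => /andP[].
Qed.

(** The values stay in a compact interval, and an ultrafilter converges to any of
    its cluster points. *)
Lemma ultra_bdd_cvg (U : set_system nat) (u : nat -> R) : UltraFilter U ->
  bdd u -> cvg (u @ U).
Proof.
move=> UU [B uB]; have := @segment_compact R (- B) B.
have UI : (u @ U) [set` `[- B, B]].
  by apply: (@filterE _ U) => n; rewrite /= in_itv/= -ler_norml.
move=> /(_ (u @ U) _ UI)[l [_ lu]]; apply/cvg_ex; exists l => N Nl.
case: (in_ultra_setVsetC (u @^-1` N) UU) => // UN.
by have [y [/= ? ?]] : (~` N) `&` N !=set0 by exact: lu.
Qed.

(** The mean is a limit of averages along an ultrafilter; the last property says
    that it remembers eventual lower bounds, hence (through - f) also limits. *)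
Lemma exists_mean T (s : nat -> seq T) : (forall n, (0 < size (s n))%N) ->
  exists2 m : (T -> R) -> R, is_mean m &
    forall f l, bdd f -> (\forall n \near \oo, l <= avg (s n) f) -> l <= m f.
Proof.
move=> s0; have [U [UU ooU]] := ultraFilterLemma eventually_filter.
have cvU f : bdd f -> cvg ((fun n => avg (s n) f) @ U).
  by move=> [B fB]; apply: ultra_bdd_cvg; exists B => n; apply: avg_norm_le.
have lb f l : bdd f -> (\forall n \near \oo, l <= avg (s n) f) ->
    l <= lim ((fun n => avg (s n) f) @ U).
  by move=> fb lf; apply: limr_ge; [exact: cvU | apply: ooU].
exists (fun f => lim ((fun n => avg (s n) f) @ U)) => //; split.
- move=> f fb f0; apply: lb => //; apply: nearW => n.
  by rewrite -(avg_cst 0 (s0 n)); apply: avg_le.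
- move=> f g fb gb; rewrite -limD; [|exact: cvU..].
  by congr (lim (_ @ U)); apply/funext => n; rewrite avgD.
- move=> c f fb; rewrite -[RHS]limZl_tmp; last exact: cvU.
  by congr (lim (_ @ U)); apply/funext => n; rewrite avgZ.
- under eq_fun do rewrite avg_cst//.
  exact: lim_cst.
Qed.

Lemma mean_invariant_of_avg T (s : nat -> seq T) (m : (T -> R) -> R) (h : T -> T) f :
  is_mean m ->
  (forall f l, bdd f -> (\forall n \near \oo, l <= avg (s n) f) -> l <= m f) ->
  bdd f ->
  (fun n => avg (s n) (fun x => f (h x)) - avg (s n) f) @ \oo --> (0 : R) ->
  m (fun x => f (h x)) = m f.
Proof.
move=> mm ml fb /cvgrPdist_le h0.
have fhb : bdd (fun x => f (h x)) by exact: bdd_comp.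
apply/eqP; rewrite -subr_eq0 -normr_le0; apply/ler_addgt0Pl => e e0; rewrite addr0.
have near_e := h0 e e0; rewrite ler_norml -{1}(meanB mm)// -[_ <= e]lerN2 opprB.
rewrite -(meanB mm)//; apply/andP; split; apply: ml; try exact: bddB.
  apply: filterS near_e => n; rewrite sub0r normrN avgB ler_norml.
  by case/andP.
apply: filterS near_e => n; rewrite sub0r normrN avgB ler_norml.
by case/andP=> _; rewrite -lerN2 opprB.
Qed.

End Means.

(** * Positive semidefinite functions *)

Section Psd.
Variables (R : realType) (V : zmodType).

Definition psd (phi : V -> R) := forall s : seq (R * V),
  0 <= \sum_(x <- s) \sum_(y <- s) x.1 * y.1 * phi (x.2 - y.2).

(** The scalar product of the unweighted sums of e_p over P and e_q over Q, when
    phi (p - q) is read as the scalar product of e_p and e_q. *)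
Definition corr (phi : V -> R) (P Q : seq V) :=
  \sum_(p <- P) \sum_(q <- Q) phi (p - q).

(** Three families are what a comparison takes: two that are compared, and the
    base point against which they are tested. *)
Lemma psd_corr3 phi (a b c : R) (P Q S : seq V) :
  psd phi -> (forall p, phi (- p) = phi p) ->
  0 <= a ^+ 2 * corr phi P P + b ^+ 2 * corr phi Q Q + c ^+ 2 * corr phi S S
     + 2 * (a * b) * corr phi P Q + 2 * (a * c) * corr phi P S
     + 2 * (b * c) * corr phi Q S.
Proof.
move=> pos even.
have corrC A B : corr phi A B = corr phi B A.
  rewrite /corr exchange_big; apply: eq_bigr => p _; apply: eq_bigr => q _.
  by rewrite -even opprB.
have blk x A y B : \sum_(p <- [seq (x, p) | p <- A])
    \sum_(q <- [seq (y, q) | q <- B]) p.1 * q.1 * phi (p.2 - q.2) =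
    x * y * corr phi A B.
  rewrite big_map mulr_sumr; apply: eq_bigr => p _.
  by rewrite big_map mulr_sumr.
have := pos ([seq (a, p) | p <- P] ++ [seq (b, p) | p <- Q]
  ++ [seq (c, p) | p <- S]).
rewrite !big_cat/=; under eq_bigr do rewrite !big_cat/=.
under [X in _ + (X + _)]eq_bigr do rewrite !big_cat/=.
under [X in _ + (_ + X)]eq_bigr do rewrite !big_cat/=.
rewrite !big_split/= !blk (corrC Q P) (corrC S P) (corrC S Q).
by congr (_ <= _); ring.
Qed.

Lemma corr_near_ge phi (P Q : seq V) l :
  (forall p q, p \in P -> q \in Q -> l <= phi (p - q)) ->
  (size P)%:R * (size Q)%:R * l <= corr phi P Q.
Proof.
move=> lphi; rewrite /corr.
have -> : (size P)%:R * (size Q)%:R * l = \sum_(p <- P) \sum_(q <- Q) l.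
  by rewrite !big_const_seq !count_predT !iter_addr_0 -mulrA !mulr_natl.
rewrite big_seq [leRHS]big_seq; apply: ler_sum => p pP.
by rewrite big_seq [leRHS]big_seq; apply: ler_sum => q qQ; apply: lphi.
Qed.

(** Each diagonal term is at most 1 <= u + 2, whence the term 2 * size P. *)
Lemma corr_pairwise_le phi (P : seq V) u :
  (forall p, phi (- p) = phi p) -> phi 0 <= 1 -> -1 <= u ->
  pairwise (fun p q => phi (p - q) <= u) P ->
  corr phi P P <= (size P)%:R ^+ 2 * u + 2 * (size P)%:R.
Proof.
move=> even phi0 u1; elim: P => [|p P IHP]/=.
  by move=> _; rewrite /corr big_nil expr0n mul0r mulr0 addr0.
case/andP => pP /IHP {}IHP.
have -> : corr phi (p :: P) (p :: P) =
    phi 0 + 2 * (\sum_(q <- P) phi (p - q)) + corr phi P P.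
  rewrite /corr big_cons big_cons subrr.
  under [X in _ + X]eq_bigr do rewrite big_cons.
  rewrite big_split/=.
  under [X in _ + (X + _)]eq_bigr do rewrite -even opprB.
  by ring.
have : \sum_(q <- P) phi (p - q) <= (size P)%:R * u.
  have -> : (size P)%:R * u = \sum_(q <- P) u.
    by rewrite big_const_seq count_predT iter_addr_0 mulr_natl.
  by rewrite big_seq [leRHS]big_seq; apply: ler_sum => q /(allP pP).
rewrite -natr1; nra.
Qed.

(** The squared norm of sum_P e_p - sum_Q e_q is O(N + N^2 eps): the main terms
    N^2 d cancel and only the diagonal and the errors remain.  Cauchy-Schwarz
    against e_o gives the bound. *)
Lemma psd_concentration phi (P Q : seq V) N d eps (o : V) :
  psd phi -> (forall p, phi (- p) = phi p) -> (forall p, `|phi p| <= 1) ->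
  0 <= eps -> `|d| <= 1 -> size P = N -> size Q = N ->
  pairwise (fun p q => `|phi (p - q) - d| <= eps) (P ++ Q) ->
  (\sum_(p <- P) phi (p - o) - \sum_(q <- Q) phi (q - o)) ^+ 2
    <= 4 * N%:R + 4 * N%:R ^+ 2 * eps.
Proof.
move=> pos even phi1 eps0 d1 sP sQ; rewrite pairwise_cat => /and3P[PQ PP QQ].
have phi01 : phi 0 <= 1 by have := phi1 0; rewrite ler_norml => /andP[].
have [dm1 _] : -1 <= d /\ d <= 1 by move: d1; rewrite ler_norml => /andP.
have up A : pairwise (fun p q => `|phi (p - q) - d| <= eps) A ->
    corr phi A A <= (size A)%:R ^+ 2 * (d + eps) + 2 * (size A)%:R.
  move=> AA; apply: corr_pairwise_le => //; first lra.
  by apply: sub_pairwise AA => p q; rewrite ler_distl => /andP[].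
have uP := up _ PP; have uQ := up _ QQ.
have lPQ : N%:R * N%:R * (d - eps) <= corr phi P Q.
  rewrite -{1}sP -sQ; apply: corr_near_ge => p q pP qQ.
  by have := allrelP PQ p q pP qQ; rewrite ler_distl => /andP[].
set S := _ - _.
(* The weight - S on o is what turns positivity into Cauchy-Schwarz. *)
have := psd_corr3 (- S) 1 (-1) [:: o] P Q pos even.
have sumo A : corr phi [:: o] A = \sum_(p <- A) phi (p - o).
  by rewrite /corr big_seq1; apply: eq_bigr => p _; rewrite -even opprB.
have oo : corr phi [:: o] [:: o] <= 1 by rewrite /corr !big_seq1 subrr.
have SE : S = corr phi [:: o] P - corr phi [:: o] Q by rewrite !sumo.
move: uP uQ; rewrite sP sQ.
have : 0 <= S ^+ 2 * (1 - corr phi [:: o] [:: o]).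
  by rewrite mulr_ge0 ?sqr_ge0// subr_ge0.
have : S * S = S * (corr phi [:: o] P - corr phi [:: o] Q) by rewrite -SE.
rewrite !expr2; clear SE; clearbody S; move: (corr _ _ _) (corr _ _ _) => *; nra.
Qed.

End Psd.

(** * Points in general position with respect to the form xy *)

Section GenericPoints.
Variable K : fieldType.
Hypothesis Kinf : infinite_set [set: K].

Lemma exists_notin (s : seq K) : exists x, x \notin s.
Proof.
apply: contrapT => /forallNP all_s; apply: Kinf.
apply: (sub_finite_set _ (finite_seq s)) => x _ /=.
by apply/negPn/negP; exact: all_s.
Qed.

Lemma exists_nonroot (p : {poly K}) : p != 0 -> exists x, ~~ root p x.
Proof.
move=> p0; apply: contrapT => /forallNP all_root.
have [s /andP[us ss]] : exists s : seq K, uniq s && (size s == size p).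
  elim: (size p) => [|n [s /andP[us /eqP ss]]]; first by exists [::].
  by have [x xs] := exists_notin s; exists (x :: s); rewrite /= xs us ss eqxx.
have rs : all (root p) s by apply/allP => x _; apply/negPn/negP; exact: all_root.
by have := max_poly_roots p0 rs us; rewrite (eqP ss) ltnn.
Qed.

Definition generic (Z : seq K) (p o : K * K) :=
  (p.1 - o.1) * (p.2 - o.2) \notin Z.

(** A new parameter t is bad for an earlier s and a value z when
    (t - s)(q/t - q/s) = z, which becomes a quadratic equation in t with leading
    coefficient q <> 0; a common non-root of these polynomials exists. *)
Lemma generic_hyperbola (q : K) (Z : seq K) N : q != 0 ->
  exists T : seq K, [/\ size T = N, all (fun t => t != 0) T &
    pairwise (generic Z) [seq (t, q / t) | t <- T]].
Proof.
move=> q0; elim: N => [|N [T [sT T0 TT]]]; first by exists [::].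
pose F (s z : K) := Poly [:: q * s ^+ 2; z * s - 2 * q * s; q].
have F0 s z : F s z != 0.
  by apply: contra_neq q0 => /(congr1 (fun p : {poly K} => p`_2)); rewrite coef_Poly coef0.
have [] := @exists_nonroot ('X * \prod_(s <- T) \prod_(z <- Z) F s z).
  rewrite mulf_neq0 ?polyX_eq0// prodf_seq_neq0; apply/allP => s _ /=.
  by rewrite prodf_seq_neq0; apply/allP => z _ /=.
move=> t; rewrite rootE hornerM hornerX mulf_eq0 negb_or horner_prod.
case/andP=> t0; rewrite prodf_seq_neq0 => /allP tT.
exists (t :: T); split=> /=; [by rewrite sT | by rewrite t0 | rewrite TT andbT].
apply/allP => _ /mapP[s sT' ->]; have s0 := allP T0 _ sT'.
apply/negP => /= zZ; have := tT _ sT'; rewrite /= horner_prod prodf_seq_neq0.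
move=> /allP/(_ _ zZ)/=/eqP; apply; rewrite /F horner_Poly/=.
by field; rewrite s0 t0.
Qed.

(** After choosing x off the earlier abscissas, each condition excludes a single
    value of y. *)
Lemma generic_points (Z : seq K) (L : seq (K * K)) N :
  exists S : seq (K * K), [/\ size S = N, pairwise (generic Z) S &
    allrel (generic Z) S L].
Proof.
elim: N => [|N [S [sS SS SL]]]; first by exists [::].
have [x xS] := exists_notin [seq o.1 | o <- S ++ L].
have [y yS] := exists_notin [seq o.2 + z / (x - o.1) | o <- S ++ L, z <- Z].
have xy o : o \in S ++ L -> generic Z (x, y) o.
  move=> oS; apply: contra yS => /= zZ; apply/allpairsP.
  exists (o, (x - o.1) * (y - o.2)); split=> //=.
  have : x - o.1 != 0.
    by rewrite subr_eq0; apply: contra xS => /eqP ->; exact: map_f.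
  by move=> ?; field.
exists ((x, y) :: S); split; rewrite /= ?sS// ?allrel_consl ?SS ?SL ?andbT.
  by apply/allP => o oS; apply: xy; rewrite mem_cat oS.
by apply/allP => o oS; apply: xy; rewrite mem_cat oS orbT.
Qed.

End GenericPoints.

(** * Positive semidefinite functions invariant under the hyperbolic torus *)

Section Torus.
Variables (R : realType) (K : fieldType).
Hypothesis Kinf : infinite_set [set: K].

Definition torus (t : K) (p : K * K) : K * K := (t * p.1, p.2 / t).

Variable phi : K * K -> R.
Hypothesis phi_psd : psd phi.
Hypothesis phi1 : forall p, `|phi p| <= 1.
Hypothesis phi_torus : forall t p, t != 0 -> phi (torus t p) = phi p.

Let phi_even p : phi (- p) = phi p.
Proof.
have := phi_torus p (_ : -1 != 0); rewrite /torus invrN1 mulrN1 mulN1r => <- //.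
by rewrite oppr_eq0 oner_eq0.
Qed.

Let phi_off_axes x y : y != 0 -> phi (x, y) = phi (x * y, 1).
Proof.
by move=> y0; rewrite -(phi_torus (x, y) y0) /torus/= divff// mulrC.
Qed.

(** Otherwise there are N disjoint pairs x, y with phi (x, 1) - phi (y, 1) > eps.
    The points (x, 0), (y, 0) have all their differences in one torus orbit, so
    [psd_concentration] with error 0 bounds the sum of the N gaps by O(sqrt N). *)
Lemma torus_invariant_oscillation (eps : R) : 0 < eps ->
  exists Z : seq K, forall x y, x \notin Z -> y \notin Z ->
    phi (x, 1) - phi (y, 1) <= eps.
Proof.
move=> eps0; apply: contrapT => /forallNP osc.
have osc' (Z : seq K) : exists x y, [/\ x \notin Z, y \notin Z & eps < phi (x, 1) - phi (y, 1)].
  apply: contrapT => noxy. apply: (osc Z) => x y xZ yZ; rewrite leNgt.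
  by apply/negP => ?; apply: noxy; exists x, y.
have pairs N : exists X Y : seq K, [/\ size X = N, size Y = N, uniq (X ++ Y) &
    N%:R * eps <= \sum_(x <- X) phi (x, 1) - \sum_(y <- Y) phi (y, 1)].
  elim: N => [|N [X [Y [sX sY uXY XY]]]].
    by exists [::], [::]; split=> //; rewrite !big_nil mul0r subrr.
  have [x [y [xXY yXY xy]]] := osc' (X ++ Y).
  have xneqy : x != y by apply: contraTneq xy => ->; rewrite subrr -leNgt ltW.
  exists (x :: X), (y :: Y); split; rewrite /= ?sX ?sY//.
    rewrite -cat1s uniq_catCA/= uXY yXY !andbT.
    by move: xXY; rewrite !mem_cat inE !negb_or xneqy => /andP[-> ->].
  rewrite !big_cons -natr1; lra.
have [N Nbig] : exists N, 4 / eps ^+ 2 < N%:R.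
  by exists (Num.bound (4 / eps ^+ 2)); apply: archi_boundP; rewrite divr_ge0 ?sqr_ge0.
have [X [Y [sX sY uXY XY]]] := pairs N.
(* The base point (0, -1) moves (x, 0) to (x, 1). *)
have := @psd_concentration R _ phi [seq (x, 0) | x <- X] [seq (y, 0) | y <- Y] N
  (phi (1, 0)) 0 (0, -1) phi_psd phi_even phi1 (lexx _) (phi1 _).
rewrite !size_map -map_cat pairwise_map !big_map => /(_ sX sY) conc.
have {conc} : (\sum_(x <- X) phi (x, 1) - \sum_(y <- Y) phi (y, 1)) ^+ 2 <= 4 * N%:R.
  have shift x : (x, 0) - (0, -1) = (x, 1) :> K * K.
    by rewrite -[LHS]/(x - 0, 0 - -1) subr0 opprK add0r.
  move: conc; rewrite mulr0 addr0; under eq_bigr do rewrite shift.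
  under [X in _ - X]eq_bigr do rewrite shift.
  apply=> //; move: uXY; rewrite uniq_pairwise; apply: sub_pairwise => x y /= xy.
  rewrite -[(x, 0) - (y, 0)]/(x - y, 0 - 0) subr0 -(@phi_torus (x - y) (1, 0)).
    by rewrite /torus/= mulr1 mul0r subrr normr0.
  by rewrite subr_eq0.
move: XY Nbig; rewrite ltr_pdivrMr ?exprn_gt0//.
set S := _ - _; have : 0 <= N%:R :> R by []. clearbody S; move: N%:R => n.
rewrite !expr2 => n0 nS nbig SS.
have : (n * eps) * (n * eps) <= S * S by apply: ler_pM => //; rewrite mulr_ge0// ltW.
nra.
Qed.

(** The value d of phi at a typical point is at least - O(eps), by positivity on
    the generic points G, and phi (1, q) is within O(sqrt eps) of d, by comparing
    the points H of the hyperbola with G. *)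
Lemma torus_invariant_hyperbola_ge0 (q : K) : q != 0 -> 0 <= phi (1, q).
Proof.
move=> q0; rewrite leNgt; apply/negP => cneg.
(* At the end (c + O(eps))^2 <= 8 eps is contradicted; c^2 / 32 is small enough
   for this because |c| <= 1. *)
pose c := phi (1, q); pose eps := c ^+ 2 / 32.
have cm1 : -1 <= c by have := phi1 (1, q); rewrite ler_norml => /andP[].
have eps0 : 0 < eps by rewrite divr_gt0// exprn_even_gt0//= lt_eqF.
(* 0 is added to Z below to keep all differences off the axes. *)
have [Z oscZ] := torus_invariant_oscillation eps0.
have [z0 z0Z] := exists_notin Kinf Z.
pose d := phi (z0, 1).
have [d_m1 d_1] : -1 <= d /\ d <= 1.
  by have := phi1 (z0, 1); rewrite ler_norml => /andP.
have [N Nbig] : exists N, eps^-1 < N%:R.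
  by exists (Num.bound eps^-1); apply: archi_boundP; rewrite invr_ge0 ltW.
have [T [sT T0 TT]] := generic_hyperbola Kinf (0 :: Z) N q0.
pose H := [seq (t, q / t) | t <- T].
have [G [sG GG GH]] := generic_points Kinf (0 :: Z) (0 :: H) N.
have near_d p o : generic (0 :: Z) p o -> `|phi (p - o) - d| <= eps.
  rewrite /generic inE negb_or => /andP[]; rewrite mulf_eq0 negb_or => /andP[_ y0] xyZ.
  rewrite -[p - o]/(p.1 - o.1, p.2 - o.2) (phi_off_axes _ y0) ler_distlC.
  by have := oscZ _ _ xyZ z0Z; have := oscZ _ _ z0Z xyZ; rewrite -/d => *; lra.
have sumH : \sum_(p <- H) phi (p - 0) = N%:R * c.
  rewrite big_map big_seq -sT -sum1_size natr_sum mulr_suml [RHS]big_seq.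
  apply: eq_bigr => t tT; rewrite subr0 mul1r /c -(@phi_torus t (1, q)) ?(allP T0)//.
  by rewrite /torus/= mulr1.
have sumG : N%:R * (d - eps) <= \sum_(p <- G) phi (p - 0).
  rewrite -sG -sum1_size natr_sum mulr_suml big_seq [leRHS]big_seq.
  apply: ler_sum => p pG; rewrite mul1r.
  by have := near_d _ _ (allrelP GH p 0 pG (mem_head _ _)); rewrite ler_distl => /andP[].
have GHpair : pairwise (fun p o => `|phi (p - o) - d| <= eps) (G ++ H).
  rewrite pairwise_cat; apply/and3P; split; last 2 first.
  - exact: sub_pairwise GG.
  - exact: sub_pairwise TT.
  apply/allrelP => p o pG oH; apply: near_d; apply: (allrelP GH) => //.
  by rewrite inE oH orbT.
have conc := psd_concentration 0 phi_psd phi_even phi1 (ltW eps0) (phi1 (z0, 1)) sG _ GHpair.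
rewrite size_map in conc; have {conc} := conc sT.
have corrG : 0 <= corr phi G G.
  have := psd_corr3 1 0 0 G G G phi_psd phi_even.
  by rewrite !(expr0n, mulr0, mul0r, addr0) expr1n mul1r.
have uG : corr phi G G <= N%:R ^+ 2 * (d + eps) + 2 * N%:R.
  rewrite -{1 2}sG; apply: corr_pairwise_le => //.
    by have := phi1 0; rewrite ler_norml => /andP[].
    lra.
  by apply: sub_pairwise GG => p o /near_d; rewrite ler_distl => /andP[].
rewrite sumH; move: corrG uG sumG Nbig; rewrite -/c in cneg *.
have : 32 * eps = c ^+ 2 by rewrite /eps; field.
rewrite -[eps^-1]div1r ltr_pdivrMr//.
move: (corr _ _ _) (\sum_(p <- G) _) => C S; have : 0 <= N%:R :> R by [].
clearbody c d eps; move: N%:R => n; rewrite !expr2.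
clear -cneg cm1 eps0 d_m1 d_1.
move=> n0 epsc C0 Cle Sge nbig SS.
have npos : 0 < n by nra.
have dge : 0 <= n * (d + eps) + 2 by nra.
have dge' : - 3 * eps <= d by nra.
have Slow : n * (- c - 4 * eps) <= S - n * c by nra.
have up : 4 * n + 4 * (n * n) * eps <= 8 * (n * n) * eps by nra.
have epsb : - c - 4 * eps >= 7 / 8 * - c by nra.
have low : (n * (7 / 8 * - c)) * (n * (7 / 8 * - c)) <= (S - n * c) * (S - n * c).
  have lowS : n * (7 / 8 * - c) <= S - n * c by nra.
  by apply: ler_pM => //; rewrite mulr_ge0// mulr_ge0// oppr_ge0 ltW.
have c2 : 0 < c * c by rewrite nmulr_rgt0.
have : 0 < n * n * (c * c) by rewrite mulr_gt0 // mulr_gt0.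
nra.
Qed.

End Torus.

(** * Averaging over the torus *)

Section TorusAverage.
Variable R : realType.

Lemma psd_mean (V : zmodType) T (m : (T -> R) -> R) (phi : T -> V -> R) :
  is_mean m -> (forall p, bdd (phi^~ p)) -> (forall t, psd (phi t)) ->
  psd (fun p => m (phi^~ p)).
Proof.
move=> mm phib pos s.
have -> : \sum_(x <- s) \sum_(y <- s) x.1 * y.1 * m (phi^~ (x.2 - y.2)) =
    m (fun t => \sum_(x <- s) \sum_(y <- s) x.1 * y.1 * phi t (x.2 - y.2)).
  rewrite (mean_sum mm) => [|x]; last by apply: bdd_sum => y; exact: bddZ.
  apply: eq_bigr => x _; rewrite (mean_sum mm) => [|y]; last exact: bddZ.
  by apply: eq_bigr => y _; rewrite (meanZ mm).
apply: (mean_ge0 mm) => [|t]; last exact: pos.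
by do 2![apply: bdd_sum => ?]; exact: bddZ.
Qed.

(** The averages over {0, ..., n} of f and of its shift differ by
    (f (n + 1) - f 0) / (n + 1). *)
Lemma exists_banach_limit : exists2 L : (nat -> R) -> R, is_mean L &
  forall f, bdd f -> L (fun n => f n.+1) = L f.
Proof.
have [|L LL Lavg] := @exists_mean R nat (fun n => iota 0 n.+1).
  by move=> n; rewrite size_iota.
exists L => // f fb; apply: (mean_invariant_of_avg LL Lavg fb).
have -> : (fun n => avg (iota 0 n.+1) (fun x => f x.+1) - avg (iota 0 n.+1) f) =
    (fun n => n.+1%:R^-1 * (f n.+1 - f 0)).
  apply/funext => n; rewrite -avgB /avg size_iota mulrC; congr (_ * _).
  by rewrite -[iota _ _]/(index_iota 0 n.+1) telescope_sumr.
have [B fB] := fb; apply/cvgr0Pnorm_le => e e0.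
have [N Nbig] : exists N, (B + B) / e < N%:R.
  have B0 : 0 <= B by exact: le_trans (fB 0).
  exists (Num.bound ((B + B) / e)); apply: archi_boundP.
  by rewrite divr_ge0 ?addr_ge0// ltW.
exists N => // n /= Nn; rewrite normrM ger0_norm// mulrC ler_pdivrMr//.
apply: (le_trans (ler_normB _ _)); apply: (le_trans (lerD (fB _) (fB _))).
rewrite mulrC -ler_pdivrMr//; apply: (le_trans (ltW Nbig)).
by rewrite ler_nat ltnW.
Qed.

(** Shift invariance makes the limit blind to finitely many terms. *)
Lemma banach_limit_eventually0 (L : (nat -> R) -> R) f N : is_mean L ->
  (forall f, bdd f -> L (fun n => f n.+1) = L f) -> bdd f ->
  (forall n, (N <= n)%N -> f n = 0) -> L f = 0.
Proof.
move=> LL Lshift; elim: N f => [|N IHN] f fb f0.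
  by rewrite -[RHS](mean_cst LL); congr L; apply/funext => n; exact: f0.
by rewrite -Lshift//; apply: IHN => [|n Nn]; [exact: bdd_comp | exact: f0].
Qed.

Variables (K : fieldType) (q : K) (eta : R).

(** The class in which the averaging takes place: it is closed under means and
    under the torus, which preserves the hyperbola xy = q. *)
Definition negative_on_hyperbola (phi : K * K -> R) :=
  [/\ psd phi, forall p, `|phi p| <= 1 &
      forall t, t != 0 -> phi (t, q / t) <= - eta].

Lemma negative_on_hyperbola_mean T (m : (T -> R) -> R) phi : is_mean m ->
  (forall t, negative_on_hyperbola (phi t)) ->
  negative_on_hyperbola (fun p => m (phi^~ p)).
Proof.
move=> mm good; have phib p : bdd (phi^~ p) by exists 1 => t; have [] := good t.
split=> [|p|t t0].
- by apply: psd_mean => // t; have [] := good t.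
- by apply: (mean_norm_le mm) => t; have [] := good t.
rewrite -[- eta](mean_cst mm); apply: (mean_le mm) => // [|x]; first exact: bdd_cst.
by have [_ _] := good x; apply.
Qed.

Lemma negative_on_hyperbola_torus t phi : t != 0 -> negative_on_hyperbola phi ->
  negative_on_hyperbola (fun p => phi (torus t p)).
Proof.
move=> t0 [pos phi1 neg]; split=> // [s|u u0].
  have := pos [seq (x.1, torus t x.2) | x <- s]; rewrite big_map.
  under eq_bigr do rewrite big_map.
  congr (_ <= _); apply: eq_bigr => x _; apply: eq_bigr => y _ /=.
  by congr (_ * phi _); rewrite /torus/= mulrBr mulrBl.
rewrite /torus/= -mulrA -invfM (mulrC u); apply: neg; exact: mulf_neq0.
Qed.

(** A Markov-Kakutani argument.  With g an enumeration of the torus, each step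
    averages over the powers of the next g k; since the torus is commutative, the
    invariance already gained is kept.  The Banach limit of the sequence of
    functions obtained is invariant under every g k. *)
Lemma exists_torus_invariant (psi : K * K -> R) : countable [set: K] ->
  negative_on_hyperbola psi ->
  exists2 phi, negative_on_hyperbola phi &
    forall t p, t != 0 -> phi (torus t p) = phi p.
Proof.
move=> Kcount psi_good; have [L LL Lshift] := exists_banach_limit.
have [g g0 gsurj] : exists2 g : nat -> K, forall n, g n != 0 &
    forall t, t != 0 -> exists n, g n = t.
  have [f finj0] := countable_injP _ Kcount.
  have finj x y : f x = f y -> x = y by move=> ?; apply: finj0; rewrite ?in_setT.
  pose P n t := t != 0 /\ f t = n.
  exists (fun n => if pselect (exists t, P n t) is left ex then projT1 (cid ex) else 1).
    by move=> n; case: pselect => [ex|_]; [case: cid => ? [] | exact: oner_neq0].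
  move=> t t0; exists (f t); case: pselect => [ex|[]]; last by exists t.
  by case: cid => x [_ fx] /=; apply: finj.
pose phi_ := fix F k := if k is k'.+1 then
  fun p => L (fun n => F k' (torus (g k' ^+ n) p)) else psi.
have phi_good k : negative_on_hyperbola (phi_ k).
  elim: k => //= k IHk; apply: negative_on_hyperbola_mean LL _ => n.
  by apply: negative_on_hyperbola_torus; rewrite ?expf_neq0.
have phi_b k : bdd (phi_ k) by exists 1; have [] := phi_good k.
have phi_inv j k p : (j < k)%N -> phi_ k (torus (g j) p) = phi_ k p.
  elim: k p => // k IHk p; rewrite ltnS leq_eqVlt => /orP[/eqP ->|jk] /=.
    (* Translating by g k shifts the sequence of powers. *)
    rewrite -(Lshift (fun n => phi_ k (torus (g k ^+ n) p))); last exact: bdd_comp.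
    congr L; apply/funext => n; congr phi_; rewrite /torus/= exprSr invfM.
    by congr pair; ring.
  congr L; apply/funext => n; rewrite -[RHS]IHk//; congr phi_.
  by rewrite /torus/=; congr pair; ring.
exists (fun p => L (phi_^~ p)); first exact: negative_on_hyperbola_mean.
have phi_b' p : bdd (phi_^~ p) by exists 1 => k; have [] := phi_good k.
move=> t p /gsurj[j <-]; apply/eqP; rewrite -subr_eq0 -(meanB LL)//; apply/eqP.
apply: (@banach_limit_eventually0 L _ j.+1) => // [|k jk]; first exact: bddB.
by rewrite phi_inv ?subrr.
Qed.

End TorusAverage.

(** * Correlations of sets and upper Banach density *)

Section Correlation.
Variables (R : realType) (A : zmodType).

Definition translation_invariant (m : (A -> R) -> R) :=
  forall f b, bdd f -> m (fun x => f (x + b)) = m f.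

(** The mean of (f - m f)^2 is nonnegative. *)
Lemma mean_sqr_le T (m : (T -> R) -> R) f : is_mean m -> bdd f ->
  m f ^+ 2 <= m (fun x => f x ^+ 2).
Proof.
move=> mm fb; have f2b : bdd (fun x => f x ^+ 2) by exact: bddM.
have fcb := bddZ (- (2 * m f)) fb.
have fcb' := bddD f2b fcb.
have : 0 <= m (fun x => f x ^+ 2 + - (2 * m f) * f x + m f ^+ 2).
  apply: (mean_ge0 mm) => [|x]; first exact: (bddD fcb' (bdd_cst _ _)).
  by rewrite (_ : _ + _ = (f x - m f) ^+ 2) ?sqr_ge0//; ring.
rewrite (meanD mm fcb' (bdd_cst _ _)) (meanD mm f2b fcb) (meanZ mm)// (mean_cst mm).
lra.
Qed.

(** The quadratic form at weights c on points p is the variance of the function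
    sum_p c_p f (x + p). *)
Lemma psd_correlation (m : (A -> R) -> R) f : is_mean m ->
  translation_invariant m -> bdd f ->
  psd (fun p => m (fun x => f x * f (x + p)) - m f ^+ 2).
Proof.
move=> mm minv fb s; pose F x := \sum_(c <- s) c.1 * f (x + c.2).
have fsb c : bdd (fun x => c.1 * f (x + c.2)) by apply: bddZ; exact: bdd_comp.
have mF : m F = \sum_(c <- s) c.1 * m f.
  rewrite (mean_sum mm)//; apply: eq_bigr => c _.
  by rewrite (meanZ mm) ?minv//; exact: bdd_comp.
have mF2 : m (fun x => F x ^+ 2) = \sum_(c <- s) \sum_(d <- s)
    c.1 * d.1 * m (fun x => f x * f (x + (c.2 - d.2))).
  have -> : (fun x => F x ^+ 2) = (fun x => \sum_(c <- s) \sum_(d <- s)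
      (c.1 * f (x + c.2)) * (d.1 * f (x + d.2))).
    by apply/funext => x; rewrite expr2 mulr_suml; apply: eq_bigr => c _; rewrite mulr_sumr.
  rewrite (mean_sum mm) => [|c]; last by apply: bdd_sum => d; exact: bddM.
  apply: eq_bigr => c _; rewrite (mean_sum mm) => [|d]; last exact: bddM.
  apply: eq_bigr => d _.
  rewrite -(minv (fun x => f x * f (x + (c.2 - d.2))) d.2); last first.
    by apply: bddM => //; exact: bdd_comp.
  rewrite -(meanZ mm); last by apply: bddM; exact: bdd_comp.
  congr m; apply/funext => x; rewrite -addrA (addrC d.2) subrK; ring.
have Fb : bdd F by exact: bdd_sum.
have := mean_sqr_le mm Fb; rewrite mF2 mF -subr_ge0; congr (_ <= _).
rewrite expr2 mulr_suml -sumrB; apply: eq_bigr => c _.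
by rewrite mulr_sumr -sumrB; apply: eq_bigr => d _; ring.
Qed.

Lemma avg_rel_density (E : set A) (F : {fset A}) : avg F \1_E = rel_density R E F.
Proof.
rewrite /avg /rel_density; congr (_ / _); rewrite card_fset_sum1 big_fset/=.
by rewrite natr_sum [RHS]big_mkcond; apply: eq_bigr => x _; rewrite indicE; case: ifP.
Qed.

(** The two sums differ only over the symmetric difference of F and F + b. *)
Lemma avg_shift_le (F : {fset A}) (f : A -> R) b B : F != fset0 ->
  (forall x, `|f x| <= B) ->
  `|avg F (fun x => f (x + b)) - avg F f| <=
    2 * B * (1 - #|` (F `&` fshift F b)%fset|%:R / #|` F|%:R).
Proof.
move=> F0 fB; set G := fshift F b.
have Fpos : 0 < #|` F|%:R :> R by rewrite ltr0n cardfs_gt0.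
have addb_inj : injective (fun x : A => x + b) by exact: addIr.
have cardG : #|` G| = #|` F| by rewrite card_imfset.
have sumG : \sum_(x <- F) f (x + b) = \sum_(y <- G) f y.
  by rewrite big_imfset//= => x y _ _; exact: addb_inj.
have diff (C D : {fset A}) : \sum_(x <- C) f x =
    \sum_(x <- (C `&` D)%fset) f x + \sum_(x <- (C `\` D)%fset) f x.
  rewrite (big_fsetID _ (mem D)) /=; congr (_ + _).
    by apply: congr_big => //; congr enum_fset; apply/fsetP => x; rewrite !inE.
  by apply: congr_big => //; congr enum_fset; apply/fsetP => x; rewrite !inE andbC.
have small (C D : {fset A}) : #|` C| = #|` F| -> #|` D| = #|` F| ->
    `|\sum_(x <- (C `\` D)%fset) f x| <= B * (#|` F|%:R - #|` (C `&` D)%fset|%:R).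
  move=> cC cD; apply: (le_trans (ler_norm_sum _ _ _)).
  rewrite -cC -(cardfsID D C) natrD addrC addKr card_fset_sum1 natr_sum mulr_sumr.
  by apply: ler_sum => x _; rewrite mulr1.
rewrite /avg -mulrBl normrM [X in _ * X]ger0_norm ?invr_ge0// ler_pdivrMr//.
rewrite sumG (diff G F) (diff F G) (fsetIC G F) opprD addrACA subrr add0r.
apply: (le_trans (ler_normB _ _)).
apply: (le_trans (lerD (small G F cardG erefl) (small F G erefl cardG))).
by rewrite (fsetIC G F) le_eqVlt; apply/orP; left; apply/eqP; field; rewrite gt_eqF.
Qed.

(** Along a Folner sequence with positive upper density, pass to a subsequence on
    which the density is bounded below, and take a limit mean. *)
Lemma exists_invariant_mean (E : set A) : (0 < upper_banach_density R E)%E ->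
  exists m : (A -> R) -> R,
    [/\ is_mean m, translation_invariant m & 0 < m \1_E].
Proof.
move=> /ereal_sup_gt[_ /= [F [F0 Finv] <-] Fpos].
have [d d0 dF] : exists2 d, 0 < d & forall n, exists2 k, (n <= k)%N &
    d <= rel_density R E (F k).
  have [d /andP[d0 dlim]] : exists d, (0 < d)%R &&
      (d%:E < limn_esup (fun n => (rel_density R E (F n))%:E))%E.
    case: limn_esup Fpos => [l| |]//; last by exists 1; rewrite ltr01 ltry.
    by rewrite lte_fin => l0; exists (l / 2); rewrite lte_fin; apply/andP; split; lra.
  exists d => // n; apply: contrapT => noF.
  move: dlim; rewrite ltNge; move/negP; apply.
  have tail : [set ereal_sup ((fun k => (rel_density R E (F k))%:E) @` V) | V in \oo]
      (ereal_sup ((fun k => (rel_density R E (F k))%:E) @` [set k | (n <= k)%N])).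
    by exists [set k | (n <= k)%N] => //; exists n.
  apply: (le_trans (ereal_inf_lbound tail)); apply: ge_ereal_sup => _ [k /= nk <-].
  by rewrite lee_fin leNgt; apply/negP => /ltW ?; apply: noF; exists k.
have [k_ k_n k_d] : exists2 k_ : nat -> nat, forall n, (n <= k_ n)%N &
    forall n, d <= rel_density R E (F (k_ n)).
  by have /choice[k_ kP] : forall n, exists k, (n <= k)%N /\ d <= rel_density R E (F k);
    [by move=> n; have [k] := dF n; exists k | exists k_ => n; have [] := kP n].
have [|m mm mavg] := @exists_mean R A (fun n => F (k_ n)).
  by move=> n; rewrite cardfs_gt0.
exists m; split=> //.
  move=> f b fb; have [B fB] := fb; apply: (mean_invariant_of_avg mm mavg fb).
  have Fk : (#|` (F (k_ n) `&` fshift (F (k_ n)) b)%fset|%:R / #|` F (k_ n)|%:R : R)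
      @[n --> \oo] --> (1 : R).
    apply: (cvg_comp _ _ _ (Finv b)).
    apply/cvgnyPge => N; exists N => // n /= Nn; exact: leq_trans (k_n n).
  apply/cvgr0Pnorm_le => e e0; pose C := `|B| + 1.
  have C0 : 0 < C by rewrite ltr_pwDr.
  have e1 : 0 < e / (2 * C) by rewrite divr_gt0// mulr_gt0.
  move/cvgrPdist_le: Fk => /(_ _ e1); apply: filterS => n near1.
  apply: (le_trans (@avg_shift_le _ _ _ C (F0 _) _)) => [x|].
    by apply: (le_trans (fB x)); rewrite (le_trans (ler_norm B))// lerDl.
  rewrite mulrC -ler_pdivlMr ?mulr_gt0//; apply: le_trans near1; exact: ler_norm.
apply: (lt_le_trans d0); apply: mavg; first exact: bdd_indic.
by apply: nearW => n; rewrite avg_rel_density.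
Qed.

End Correlation.

(** * Large sets of the plane *)

Section Plane.
Variables (R : realType) (K : fieldType).
Hypotheses (Kcount : countable [set: K]) (Kinf : infinite_set [set: K]).

(** Without such u and v, the correlation of E vanishes on the hyperbola, so its
    centered version is a counterexample to [torus_invariant_hyperbola_ge0] once
    averaged over the torus. *)
Lemma exists_difference_on_hyperbola (m : (K * K -> R) -> R) (E : set (K * K)) q :
  is_mean m -> translation_invariant m -> 0 < m \1_E -> q != 0 ->
  exists u v, [/\ E u, E v & (v.1 - u.1) * (v.2 - u.2) = q].
Proof.
move=> mm minv mE q0; apply: contrapT => noE.
pose f : K * K -> R := \1_E; have fb : bdd f by exact: bdd_indic.
have f01 x : 0 <= f x <= 1 by rewrite /f indicE; case: (_ \in _); rewrite ?lexx ler01.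
pose psi p := m (fun x => f x * f (x + p)) - m f ^+ 2.
have ffb p : bdd (fun x => f x * f (x + p)) by apply: bddM => //; exact: bdd_comp.
have mf1 : m f <= 1.
  rewrite -(mean1 mm); apply: (mean_le mm) => // [|x]; first exact: bdd_cst.
  by case/andP: (f01 x).
have psi_good : negative_on_hyperbola q (m f ^+ 2) psi.
  split=> [|p|t t0]; first exact: psd_correlation.
    have m0 : 0 <= m (fun x => f x * f (x + p)).
      by apply: (mean_ge0 mm) => // x; have /andP[? _] := f01 x;
        have /andP[? _] := f01 (x + p); rewrite mulr_ge0.
    have m1 : m (fun x => f x * f (x + p)) <= 1.
      rewrite -(mean1 mm); apply: (mean_le mm) => // [|x]; first exact: bdd_cst.
      by have /andP[? ?] := f01 x; have /andP[? ?] := f01 (x + p); rewrite mulr_ile1.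
    by rewrite /psi ler_norml expr2; apply/andP; split; nra.
  rewrite /psi (_ : (fun x => _) = fun=> 0) ?(mean_cst mm) ?sub0r//.
  apply/funext => x; rewrite /f !indicE.
  case: (boolP (x \in E)) => [/set_mem Ex|_]; rewrite ?mul0r//.
  case: (boolP (x + _ \in E)) => [/set_mem Ey|_]; rewrite ?mulr0//; case: noE.
  exists x, (x + (t, q / t)); split=> //=.
  by rewrite !(addrC x.1, addrC x.2) !addrK; field.
have [phi [pos phi1 neg] phi_inv] := exists_torus_invariant Kcount psi_good.
have := torus_invariant_hyperbola_ge0 Kinf pos phi1 phi_inv q0.
apply/negP; rewrite -ltNge; have := neg 1 (oner_neq0 _); rewrite divr1 => /le_lt_trans.
by apply; rewrite oppr_lt0 exprn_gt0.
Qed.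

End Plane.

Theorem corollary1p26 (R : realType) (K : fieldType) (E : set (K * K)%type)
  (Kcount : countable [set: K]) (Kinf : infinite_set [set: K])
  (Epos : (0 < upper_banach_density R E)%E) :
  Prod (diffset E) = [set: K] /\
  (forall Q : set K, finite_set Q ->
     exists2 u : (K * K)%type, E u & Q `<=` Prod (translate_sub E u)).
Proof.
suff finQ : forall Q : set K, finite_set Q ->
    exists2 u : (K * K)%type, E u & Q `<=` Prod (translate_sub E u).
  split=> //; apply/seteqP; split=> // q _.
  have [u Eu /(_ q erefl)[p [v Ev vp] pq]] := finQ [set q] (finite_set1 q).
  by exists p => //; rewrite -vp; exists v => //; exists u.
move=> _ /finite_seqP[Q ->]; apply: contrapT => noE.
have [m [mm minv mE]] := exists_invariant_mean Epos.
pose bad q := [set u | E u /\ ~ Prod (translate_sub E u) q].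
have [q _ mq] : exists2 q, q \in Q & 0 < m \1_(bad q).
  apply: contrapT => nobad; move: mE; apply/negP; rewrite -leNgt.
  have : m \1_E <= \sum_(q <- Q) m \1_(bad q).
    rewrite -(mean_sum mm) => [|q]; last exact: bdd_indic.
    apply: (mean_le mm) => [||u]; [exact: bdd_indic| |].
      by apply: bdd_sum => q; exact: bdd_indic.
    rewrite indicE; case: (boolP (u \in E)) => [/set_mem Eu|_]; last by rewrite sumr_ge0.
    have [q qQ badq] : exists2 q, q \in Q & bad q u.
      apply: contrapT => nobadu; apply: noE; exists u => // q /= qQ.
      by apply: contrapT => nq; apply: nobadu; exists q.
    rewrite (big_rem q)//= [X in X + _]indicE mem_set// lerDl.
    by rewrite sumr_ge0// => ? _; rewrite indicE.
  move/le_trans; apply; rewrite big_seq sumr_le0// => q qQ; rewrite leNgt.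
  by apply/negP => ?; apply: nobad; exists q.
have [q0|q0] := eqVneq q 0.
  move: mq; rewrite (_ : bad q = set0) ?indic0; last first.
    apply/seteqP; split=> // u [Eu]; apply; exists 0; last by rewrite q0 mul0r.
    by exists u => //; rewrite subrr.
  by rewrite (mean_cst mm) ltxx.
have [u [v [[_ badu] [Ev _] uv]]] := exists_difference_on_hyperbola Kcount Kinf mm minv mq q0.
by apply: badu; exists (v - u) => //; exists v.
Qed.
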